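(* Let $\mathcal{C}=\{\mu\in\mathbb{R}^{N}: \mu_l\le\mu\le\mu_u\}$ and let $F$, the models $m_k$, and the sequences $\{\mu_k\}$, $\{\Delta_k\}$, $\{\check\mu_k\}$ be as generated by the inexact-gradient trust-region algorithm described in the context, applied to the problem of minimizing $F$ over $\mathcal{C}$. Suppose that: (1) $F$ is twice continuously differentiable and bounded below; (2) each $m_k$ is twice continuously differentiable; (3) there exist $\zeta_1>0$, $\zeta_2>1$ such that $\|\nabla^2F(\mu)\|\le\zeta_1$ and $\|\nabla^2m_k(\mu)\|\le\zeta_2-1$ for all $\mu\in\mathcal{C}$ and all $k$; (4) there exists $\xi>0$, independent of $k$, such that $\|\nabla m_k(\mu_k)-\nabla F(\mu_k)\|\le\xi\min\{\|\chi_m(\mu_k)\|,\Delta_k\}$ for all $k$; (5) there exists $\beta>0$ such that $\beta_k\le\beta$ for all $k$, where $\beta_k:=1+\max_{x\in\mathcal{C}_{\Delta_k}}\|\nabla^2m_k(x)\|_2$; (6) there exists $\kappa\in(0,1)$, independent of $k$, such that for all $k$ $$m_k(\mu_k)-m_k(\check\mu_k)\ \ge\ \kappa\,\|\chi_m(\mu_k)\|\,\min\Big[\frac{\|\chi_m(\mu_k)\|}{\beta_k},\,\Delta_k\Big].$$ Then $$\liminf_{k\to\infty}\|\chi_m(\mu_k)\|=\liminf_{k\to\infty}\|\chi(\mu_k)\|=0 .$$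
   Context: Setting. $\mu_l\le\mu_u$ are vectors in $\mathbb{R}^N$, inequalities between vectors are componentwise, and $P(x)$ denotes the Euclidean projection of $x$ onto the box $\mathcal{C}=[\mu_l,\mu_u]$ (componentwise clipping). $\|\cdot\|$ is a fixed norm on $\mathbb{R}^N$ (with induced matrix norm); $\|\cdot\|_2$ is the spectral norm. $F$ and all $m_k$ are real-valued functions defined on an open set containing $\mathcal{C}$. Projected gradients: $\chi(\mu):=P(\mu-\nabla F(\mu))-\mu$, and at iteration $k$, $\chi_m(\mu):=P(\mu-\nabla m_k(\mu))-\mu$ (so $\chi_m(\mu_k)$ is computed with the model $m_k$). Trust region: $\mathcal{C}_{\Delta_k}:=\{\mu\in\mathcal{C}:\|\mu-\mu_k\|\le\Delta_k\}$. Inexact-gradient trust-region algorithm. Parameters: $0<\gamma_1\le\gamma_2<1$, $\Delta_{\max}>0$, $0<\eta_1<\eta_2<1$; start from a point of $\mathcal{C}$ and a radius in $(0,\Delta_{\max}]$. At iteration $k$, with center $\mu_k\in\mathcal{C}$ and radius $\Delta_k>0$: (i) choose a model $m_k$; (ii) compute a candidate $\check\mu_k\in\mathcal{C}_{\Delta_k}$ by approximately minimizing $m_k$ over $\mathcal{C}_{\Delta_k}$; (iii) compute $\varrho_k=\dfrac{F(\mu_k)-F(\check\mu_k)}{m_k(\mu_k)-m_k(\check\mu_k)}$; (iv) if $\varrho_k\ge\eta_1$ set $\mu_{k+1}=\check\mu_k$ (successful iteration), otherwise $\mu_{k+1}=\mu_k$; (v) choose $\Delta_{k+1}\in[\gamma_1\Delta_k,\gamma_2\Delta_k]$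 if $\varrho_k<\eta_1$; $\Delta_{k+1}\in[\gamma_2\Delta_k,\Delta_k]$ if $\varrho_k\in[\eta_1,\eta_2)$; $\Delta_{k+1}\in[\Delta_k,\Delta_{\max}]$ if $\varrho_k\ge\eta_2$. The algorithm is run without termination, producing infinite sequences with all $\varrho_k$ well defined. *)

(* Defs.v *)
From HB Require Import structures.
From mathcomp Require Import all_boot all_order all_algebra.
From mathcomp Require Import all_classical all_reals all_analysis.

Set Implicit Arguments.
Unset Strict Implicit.
Unset Printing Implicit Defensive.

Import Order.TTheory GRing.Theory Num.Theory.
Import numFieldNormedType.Exports.

Local Open Scope classical_set_scope.
Local Open Scope ring_scope.

(* R^N is the space of column vectors 'cV[R]_N. Its library topology is the
   usual one, and `differentiable`, `continuous`, `open` below refer to it. *)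

Record is_norm (R : realType) (N : nat) (nrm : 'cV[R]_N -> R) : Prop := IsNorm {
  norm_eq0 : forall x, nrm x = 0 -> x = 0;
  norm_scale : forall (a : R) x, nrm (a *: x) = `|a| * nrm x;
  norm_triangle : forall x y, nrm (x + y) <= nrm x + nrm y
}.

Definition induced_norm (R : realType) (N : nat) (nrm : 'cV[R]_N -> R)
    (A : 'M[R]_N) : R :=
  sup [set nrm (A *m x) | x in [set x | nrm x <= 1]].

Definition euclid_norm (R : realType) (N : nat) (x : 'cV[R]_N) : R :=
  Num.sqrt (\sum_i x i 0 ^+ 2).

Definition spectral_norm (R : realType) (N : nat) (A : 'M[R]_N) : R :=
  induced_norm (@euclid_norm R N) A.

Definition grad (R : realType) (N : nat) (f : 'cV[R]_N -> R) (x : 'cV[R]_N) :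
    'cV[R]_N :=
  \col_i 'D_(delta_mx i 0) f x.

Definition hess (R : realType) (N : nat) (f : 'cV[R]_N -> R) (x : 'cV[R]_N) :
    'M[R]_N :=
  \matrix_(i, j) 'D_(delta_mx j 0) (fun y => grad f y i 0) x.

(* Functions are total on 'cV[R]_N, but for an open U everything here depends
   only on the values of f on U. *)
Definition twice_cont_diff (R : realType) (N : nat) (U : set 'cV[R]_N)
    (f : 'cV[R]_N -> R) : Prop :=
  forall x, U x ->
    [/\ differentiable f x, differentiable (grad f) x & {for x, continuous (hess f)}].

Definition box (R : realType) (N : nat) (lo up : 'cV[R]_N) : set 'cV[R]_N :=
  [set x | forall i, lo i 0 <= x i 0 <= up i 0].

Definition proj_box (R : realType) (N : nat) (lo up x : 'cV[R]_N) : 'cV[R]_N :=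
  \col_i Num.max (lo i 0) (Num.min (up i 0) (x i 0)).

(* Componentwise clipping is the Euclidean projection onto the box. *)
Lemma proj_box_in (R : realType) (N : nat) (lo up x : 'cV[R]_N) :
  (forall i, lo i 0 <= up i 0) -> box lo up (proj_box lo up x).
Proof.
move=> lu i; rewrite mxE le_max lexx /= ge_max lu /=.
by rewrite ge_min lexx.
Qed.

Lemma proj_box_closest (R : realType) (N : nat) (lo up x z : 'cV[R]_N) :
  box lo up z -> euclid_norm (x - proj_box lo up x) <= euclid_norm (x - z).
Proof.
move=> zb; rewrite ler_wsqrtr //; apply: ler_sum => i _.
rewrite -[leLHS]real_normK ?num_real // -[leRHS]real_normK ?num_real //.
rewrite lerXn2r ?nnegrE ?normr_ge0 // !mxE.
move: (zb i) => /andP[lz zu].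
have lu := le_trans lz zu.
rewrite maxEle minEle; case: (leP (up i 0) (x i 0)) => ux.
  by rewrite lu !ger0_norm ?subr_ge0 ?lerB // (le_trans zu).
case: (leP (lo i 0) (x i 0)) => lx; first by rewrite subrr normr0.
have xz : x i 0 <= z i 0 by rewrite (le_trans (ltW lx)).
by rewrite distrC [leRHS]distrC !ger0_norm ?subr_ge0 ?lerB // ltW.
Qed.

(* With f the objective this is chi, with f the model m_k it is chi_m. *)
Definition proj_grad (R : realType) (N : nat) (lo up : 'cV[R]_N)
    (f : 'cV[R]_N -> R) (x : 'cV[R]_N) : 'cV[R]_N :=
  proj_box lo up (x - grad f x) - x.

Definition trust_region (R : realType) (N : nat) (nrm : 'cV[R]_N -> R)
    (lo up center : 'cV[R]_N) (radius : R) : set 'cV[R]_N :=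
  [set x | box lo up x /\ nrm (x - center) <= radius].

Definition curvature_bound (R : realType) (N : nat) (nrm : 'cV[R]_N -> R)
    (lo up center : 'cV[R]_N) (radius : R) (model : 'cV[R]_N -> R) : R :=
  1 + sup [set spectral_norm (hess model x)
          | x in trust_region nrm lo up center radius].

Definition reduction_ratio (R : realType) (N : nat)
    (F model : 'cV[R]_N -> R) (center cand : 'cV[R]_N) : R :=
  (F center - F cand) / (model center - model cand).

(* The choices made by the algorithm (models, candidates, radii) are data; a
   run is any choice compatible with its rules. The quality of the approximate
   minimizer is not prescribed by the algorithm itself. *)
Record tr_run (R : realType) (N : nat) (nrm : 'cV[R]_N -> R)
    (lo up : 'cV[R]_N) (gamma1 gamma2 Delta_max eta1 eta2 : R)
    (F : 'cV[R]_N -> R) (m : nat -> 'cV[R]_N -> R)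
    (mu cand : nat -> 'cV[R]_N) (Delta : nat -> R) : Prop := TRRun {
  tr_start : box lo up (mu 0%N);
  tr_start_radius : 0 < Delta 0%N <= Delta_max;
  tr_cand : forall k, trust_region nrm lo up (mu k) (Delta k) (cand k);
  tr_ratio_defined : forall k, m k (mu k) - m k (cand k) != 0;
  tr_accept : forall k,
    eta1 <= reduction_ratio F (m k) (mu k) (cand k) -> mu k.+1 = cand k;
  tr_reject : forall k,
    reduction_ratio F (m k) (mu k) (cand k) < eta1 -> mu k.+1 = mu k;
  tr_radius_fail : forall k,
    reduction_ratio F (m k) (mu k) (cand k) < eta1 ->
    gamma1 * Delta k <= Delta k.+1 <= gamma2 * Delta k;
  tr_radius_success : forall k,
    eta1 <= reduction_ratio F (m k) (mu k) (cand k) < eta2 ->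
    gamma2 * Delta k <= Delta k.+1 <= Delta k;
  tr_radius_very_success : forall k,
    eta2 <= reduction_ratio F (m k) (mu k) (cand k) ->
    Delta k <= Delta k.+1 <= Delta_max
}.

(* Main.v *)
Require Import Defs.
From HB Require Import structures.
From mathcomp Require Import all_boot all_order all_algebra.
From mathcomp Require Import all_classical all_reals all_analysis.
From mathcomp Require Import ring lra.
Import Order.TTheory GRing.Theory Num.Theory.
Import numFieldNormedType.Exports.
Local Open Scope classical_set_scope.
Local Open Scope ring_scope.

(** The projected model gradients cannot stay bounded away from [0], and the
true projected gradients are dominated by them.

Suppose that [chi_m >= e] from some iteration on. On the box the second-order
remainders of [F] and of the model are [O(Delta ^ 2)] because the Hessians are
bounded, and the first-order mismatch is [O(Delta ^ 2)] as well because the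
gradient error is [O(Delta)]. So actual and predicted reductions differ by at
most [A * Delta ^ 2] ([reduction_error]), while the predicted reduction is at
least [kappa * e * Delta] for small [Delta]. Hence a small radius forces a very
successful iteration, after which the radius does not decrease, and the radii
stay above some [Dmin > 0] ([radius_bounded_below]).

Every iteration now either decreases [F] by a fixed amount (success) or leaves
[F] unchanged and shrinks the radius, which lies
between [Dmin] and [Delta_max], by the factor [gamma2]. For a small enough [a > 0] the
potential [F (mu k) + a * Delta k] then drops by a fixed amount at every
iteration ([no_endless_decrease_or_shrinking]), although [F] is bounded below:
a contradiction ([tr_run_not_bounded_away]).

Clipping is nonexpansive in each coordinate, so [chi <= chi_m + K * error]
([proj_grad_perturb]); as the gradient error is at most [xi * chi_m], this gives
[chi <= (1 + K * xi) * chi_m], and [chi] too becomes arbitrarily small. *)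

Set Implicit Arguments.
Unset Strict Implicit.
Unset Printing Implicit Defensive.

(** * Lower limits *)

Lemma limn_einf_eq0 (R : realType) (u : nat -> R) :
  (forall k, 0 <= u k) ->
  (forall e K, 0 < e -> exists2 k, (K <= k)%N & u k < e) ->
  limn_einf (fun k => (u k)%:E) = 0%E.
Proof.
move=> u0 uinf; rewrite limn_einf_lim.
suff -> : einfs (fun k => (u k)%:E) = cst 0%E by rewrite lim_cst.
apply/funext => K; apply/eqP; rewrite eq_le; apply/andP; split; last first.
  by apply: le_ereal_inf_tmp => _ [k _ <-]; rewrite lee_fin.
apply/lee_addgt0Pr => e e0; rewrite add0e.
have [k Kk uke] := uinf e K e0.
apply: (@le_trans _ _ (u k)%:E); last by rewrite lee_fin ltW.
by apply: ereal_inf_lbound; exists k.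
Qed.

Lemma arbitrarily_small_of_not_bounded_away (R : realType) (u : nat -> R) :
  (forall e K, 0 < e -> ~ (forall k, (K <= k)%N -> e <= u k)) ->
  forall e K, 0 < e -> exists2 k, (K <= k)%N & u k < e.
Proof.
move=> H e K e0; apply: contrapT => nex; apply: (H e K e0) => k Kk.
by rewrite leNgt; apply/negP => uke; apply: nex; exists k.
Qed.

(** * Norms on column vectors *)

Lemma norm_zero (R : realType) N (nrm : 'cV[R]_N -> R) : is_norm nrm -> nrm 0 = 0.
Proof. by move=> h; rewrite -(scale0r 0) (norm_scale h) normr0 mul0r. Qed.

Lemma norm_opp (R : realType) N (nrm : 'cV[R]_N -> R) x :
  is_norm nrm -> nrm (- x) = nrm x.
Proof. by move=> h; rewrite -scaleN1r (norm_scale h) normrN1 mul1r. Qed.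

Lemma norm_ge0 (R : realType) N (nrm : 'cV[R]_N -> R) x : is_norm nrm -> 0 <= nrm x.
Proof.
move=> h; have := norm_triangle h x (- x).
by rewrite subrr (norm_zero h) (norm_opp _ h) -mulr2n pmulrn_lge0.
Qed.

Lemma norm_sum (R : realType) N (nrm : 'cV[R]_N -> R) n (x : 'I_n -> 'cV[R]_N) :
  is_norm nrm -> nrm (\sum_i x i) <= \sum_i nrm (x i).
Proof.
move=> h; elim/big_ind2 : _ => //; first by rewrite (norm_zero h).
by move=> a s b t ab cd; rewrite (le_trans (norm_triangle h _ _)) ?lerD.
Qed.

Lemma col_sum_delta (R : realType) N (x : 'cV[R]_N) :
  x = \sum_i x i 0 *: delta_mx i 0.
Proof. by rewrite [LHS]matrix_sum_delta; apply: eq_bigr => i _; rewrite big_ord1. Qed.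

Lemma norm_le_coord (R : realType) N (nrm : 'cV[R]_N -> R) :
  is_norm nrm -> exists2 C : R, 0 <= C &
    forall (x : 'cV[R]_N) b, (forall i, `|x i 0| <= b) -> nrm x <= C * b.
Proof.
move=> h; exists (\sum_i nrm (delta_mx i 0)).
  by apply: sumr_ge0 => i _; exact: norm_ge0.
move=> x b xb; rewrite {1}(col_sum_delta x) (le_trans (norm_sum _ h))//.
rewrite mulr_suml; apply: ler_sum => i _.
by rewrite (norm_scale h) mulrC ler_wpM2l// norm_ge0.
Qed.

Lemma le_mx_norm_coord (R : realType) m n (A : 'M[R]_(m, n)) i j : `|A i j| <= `|A|.
Proof.
rewrite [leRHS]/Num.Def.normr/= mx_normrE.
exact: (le_bigmax _ (fun ij => `|A ij.1 ij.2|) (i, j)).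
Qed.

(** The hard half of the equivalence of norms in finite dimension: a norm is
continuous by [norm_le_coord], so it attains a minimum on the unit sphere of the
coordinate norm, and this minimum is positive. *)
Lemma coord_le_norm (R : realType) N (nrm : 'cV[R]_N -> R) :
  is_norm nrm -> exists2 c : R, 0 <= c &
    forall (x : 'cV[R]_N) i, `|x i 0| <= c * nrm x.
Proof.
move=> h; have [C C0 nrmC] := norm_le_coord h.
have nrm_lip (v w : 'rV[R]_N) : nrm v^T - nrm w^T <= C * `|v - w|.
  rewrite lerBlDr -{1}(subrK w v) linearD (le_trans (norm_triangle h _ _))//.
  by rewrite lerD2r nrmC// => i; rewrite mxE le_mx_norm_coord.
pose S := [set v : 'rV[R]_N | `|v| = 1].
have [S0|nS0] := pselect (S !=set0); last first.
  (* The sphere is empty only in dimension 0. *)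
  exists 0 => // x i; rewrite mul0r normr_le0; apply/eqP.
  apply: contrapT => /eqP xi0; apply: nS0; exists (`|x^T|^-1 *: x^T).
  rewrite /S /= normrZ normfV normr_id mulVf// normr_eq0.
  by apply: contra xi0 => /eqP/matrixP/(_ 0 i); rewrite !mxE => ->.
(* The compactness criterion is stated for row vectors, hence the transposes. *)
have cS : compact S.
  apply: bounded_closed_compact.
    by exists 1; split=> // M M1 v /= ->; exact: ltW.
  rewrite (_ : S = (fun v : 'rV[R]_N => `|v|) @^-1` [set 1]).
    by apply: preimage_closed => [v _|]; [exact: norm_continuous|exact: closed_eq].
  by [].
have cn : continuous (fun v : 'rV[R]_N => nrm v^T).
  move=> v; apply/(@cvgrPdist_le _ _ _ (nbhs v)) => e e0; near=> w.
  have vw : C * `|v - w| <= e.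
    apply: (@le_trans _ _ ((C + 1) * `|v - w|)).
      by rewrite ler_wpM2r// lerDl.
    rewrite -ler_pdivlMl ?ltr_wpDl//.
    near: w; apply: cvgr_dist_le; [exact: cvg_id|].
    by rewrite mulr_gt0// invr_gt0 ltr_wpDl.
  rewrite ler_norml lerNl opprB.
  by rewrite (le_trans (nrm_lip _ _) vw) (le_trans (nrm_lip _ _)) // distrC.
have [v] := EVT_min_rV S0 cS (continuous_subspaceT cn).
rewrite inE /S /= => v1 vmin.
have v0 : 0 < nrm v^T.
  rewrite lt_neqAle (norm_ge0 _ h) andbT eq_sym; apply/eqP => /(norm_eq0 h).
  move=> /(congr1 trmx); rewrite trmxK trmx0 => v0.
  by move: v1; rewrite v0 normr0 => /esym/eqP; rewrite oner_eq0.
exists (nrm v^T)^-1; first by rewrite invr_ge0 ltW.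
move=> x i; rewrite ler_pdivlMl//.
have [x0|x0] := eqVneq `|x^T| 0.
  have /matrixP/(_ 0 i) := normr0_eq0 x0; rewrite !mxE => ->.
  by rewrite normr0 mulr0 norm_ge0.
have x_gt0 : 0 < `|x^T| by rewrite lt_neqAle eq_sym x0/=.
have /vmin : `|x^T|^-1 *: x^T \in S.
  by rewrite inE /S /= normrZ normfV normr_id mulVf.
rewrite linearZ/= trmxK (norm_scale h) normfV normr_id ler_pdivlMl// mulrC.
apply: le_trans; rewrite ler_wpM2l ?norm_ge0//.
by rewrite (_ : x i 0 = x^T 0 i) ?le_mx_norm_coord// mxE.
Unshelve. all: by end_near. Qed.

(** Since [sup] takes the value [0] on unbounded sets, the inequality rests on
the image of the unit ball being bounded, which follows from the comparison with
coordinates. *)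
Lemma le_induced_norm (R : realType) N (nrm : 'cV[R]_N -> R) (A : 'M[R]_N) x :
  is_norm nrm -> nrm (A *m x) <= induced_norm nrm A * nrm x.
Proof.
move=> h; have [C C0 nrmC] := norm_le_coord h.
have [c c0 nrmc] := coord_le_norm h.
have [->|x0] := eqVneq x 0; first by rewrite mulmx0 (norm_zero h) mulr0.
have nx : 0 < nrm x.
  rewrite lt_neqAle norm_ge0// andbT eq_sym.
  by apply: contra x0 => /eqP/(norm_eq0 h) ->.
rewrite -ler_pdivrMr// mulrC -[X in X * _]ger0_norm ?invr_ge0 ?norm_ge0//.
rewrite -(norm_scale h) scalemxAr; apply: ub_le_sup; last first.
  exists ((nrm x)^-1 *: x) => //=.
  by rewrite (norm_scale h) ger0_norm ?invr_ge0 ?norm_ge0// mulVf ?gt_eqF.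
exists (C * (N%:R * (`|A| * c))) => _ [y /= y1 <-]; apply: nrmC => i.
rewrite mxE (le_trans (ler_norm_sum _ _ _))//.
apply: (@le_trans _ _ (\sum_(j < N) `|A| * c)); last first.
  by rewrite sumr_const card_ord mulr_natl.
apply: ler_sum => j _; rewrite normrM ler_pM ?le_mx_norm_coord//.
by rewrite (le_trans (nrmc _ _))// -[leRHS]mulr1 ler_wpM2l.
Qed.

(** The derivatives are tested against this bilinear form, while sizes are
measured in an arbitrary norm; [dot_le_norm] plays the part of the
Cauchy-Schwarz inequality. *)
Definition dot (R : realType) N (u v : 'cV[R]_N) : R := \sum_i u i 0 * v i 0.

Lemma dotBl (R : realType) N (u v w : 'cV[R]_N) : dot (u - v) w = dot u w - dot v w.
Proof. by rewrite -sumrB; apply: eq_bigr => i _; rewrite !mxE mulrBl. Qed.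

Lemma dot_le_norm (R : realType) N (nrm : 'cV[R]_N -> R) : is_norm nrm ->
  exists2 C : R, 0 <= C & forall u v : 'cV[R]_N, `|dot u v| <= C * (nrm u * nrm v).
Proof.
move=> h; have [c c0 nrmc] := coord_le_norm h.
exists (N%:R * (c * c)); first by rewrite !mulr_ge0.
move=> u v; rewrite (le_trans (ler_norm_sum _ _ _))// -mulrA mulr_natl.
rewrite -[X in _ *+ X]card_ord -sumr_const; apply: ler_sum => i _.
by rewrite normrM mulrACA ler_pM.
Qed.

(** * Second-order expansion on a box *)

Lemma derive_dot_grad (R : realType) N (f : 'cV[R]_N -> R) (x d : 'cV[R]_N) :
  differentiable f x -> 'D_d f x = dot (grad f x) d.
Proof.
move=> df; rewrite deriveE// {1}(col_sum_delta d) linear_sum.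
by apply: eq_bigr => i _; rewrite linearZ mxE deriveE//= mulrC.
Qed.

Lemma mean_value_line (R : realType) N (f : 'cV[R]_N -> R) (x d : 'cV[R]_N) :
  (forall t : R, 0 <= t <= 1 -> differentiable f (x + t *: d)) ->
  exists2 t : R, 0 <= t <= 1 & f (x + d) - f x = 'D_d f (x + t *: d).
Proof.
move=> df; pose phi (t : R) : R := f (x + t *: d).
have dphi (t : R) : 0 <= t <= 1 -> is_derive t 1 phi ('D_d f (x + t *: d)).
  move=> t01; have Df : derivable f (x + t *: d) d by exact/diff_derivable/df.
  have E : (fun h : R => h^-1 *: (phi (h *: 1 + t) - phi t)) =
           (fun h : R => h^-1 *: (f (h *: d + (x + t *: d)) - f (x + t *: d))).
    apply/funext => h; rewrite /phi; congr (_ *: (f _ - _)).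
    by rewrite [h *: 1]mulr1 scalerDl addrCA.
  by split; rewrite ?/derivable ?/derive E.
have [||t t01] := @MVT_segment R phi (fun t => 'D_d f (x + t *: d)) 0 1 ler01.
- by move=> t; rewrite in_itv/= => /andP[t0 t1]; apply: dphi; rewrite !ltW.
- apply: continuous_in_subspaceT => t; rewrite inE/= in_itv/= => t01.
  have Dp := dphi _ t01.
  by apply: differentiable_continuous; exact/derivable1_diffP.
rewrite subr0 mulr1 /phi scale1r scale0r addr0 => fE.
by exists t => //; move: t01; rewrite in_itv.
Qed.

(** Pairing the gradient with a fixed vector yields a scalar function, to which
the scalar mean value theorem applies; this is how the Hessian enters without a
second-order Taylor formula for vector-valued maps. *)
Lemma derive_dot_hess (R : realType) N (f : 'cV[R]_N -> R) (x d w : 'cV[R]_N) :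
  differentiable (grad f) x ->
  differentiable (fun y => dot (grad f y) d) x /\
  'D_w (fun y => dot (grad f y) d) x = dot (hess f x *m w) d.
Proof.
move=> dg.
have dgi i : differentiable (fun y => grad f y i 0) x.
  apply: (@differentiable_comp _ _ _ _ (grad f) (fun M : 'cV[R]_N => M i 0)) => //.
  exact: differentiable_coord.
pose h i : 'cV[R]_N -> R := d i 0 *: (fun y => grad f y i 0).
have E : (fun y => dot (grad f y) d) = \sum_i h i.
  by apply/funext => y; rewrite fct_sumE; apply: eq_bigr => i _; rewrite mulrC.
have dh i : differentiable (h i) x by exact: differentiableZ.
rewrite E; split; first exact: differentiable_sum.
rewrite derive_sum; last by move=> i; exact: diff_derivable.
apply: eq_bigr => i _.
rewrite deriveZ; last exact: diff_derivable.
rewrite derive_dot_grad// [LHS]mulrC; congr (_ * _).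
by rewrite mxE; apply: eq_bigr => j _; rewrite !mxE.
Qed.

Lemma box_segment (R : realType) N (lo up x y : 'cV[R]_N) (t : R) :
  box lo up x -> box lo up y -> 0 <= t <= 1 -> box lo up (x + t *: (y - x)).
Proof.
move=> bx by_ /andP[t0 t1] i; rewrite !mxE.
by have /andP[? ?] := bx i; have /andP[? ?] := by_ i; apply/andP; split; nra.
Qed.

(** Two mean value theorems: [f y - f x] is the slope of [f] at an intermediate
point [x + t *: d], and the change of that slope from [x] is a value of the
Hessian form at a point between these two. All the points are in the box by
convexity. *)
Lemma taylor_box (R : realType) N (nrm : 'cV[R]_N -> R) (lo up : 'cV[R]_N)
    (U : set 'cV[R]_N) (f : 'cV[R]_N -> R) (C B : R) (x y : 'cV[R]_N) :
  is_norm nrm -> box lo up `<=` U -> twice_cont_diff U f ->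
  0 <= C -> (forall u v : 'cV[R]_N, `|dot u v| <= C * (nrm u * nrm v)) ->
  0 <= B -> (forall z, box lo up z -> induced_norm nrm (hess f z) <= B) ->
  box lo up x -> box lo up y ->
  `|f y - f x - dot (grad f x) (y - x)| <= C * (B * nrm (y - x) ^+ 2).
Proof.
move=> h bU fC2 C0 dotC B0 hB bx by_; set d := y - x.
have bz (t : R) : 0 <= t <= 1 -> box lo up (x + t *: d) by exact: box_segment.
have Bd0 : 0 <= B * (nrm d * nrm d) by rewrite !mulr_ge0 ?norm_ge0.
have [t t01] := @mean_value_line _ _ f x d
  (fun t t01 => let: And3 p _ _ := fC2 _ (bU _ (bz t t01)) in p).
rewrite derive_dot_grad; last by case: (fC2 _ (bU _ (bz t t01))).
rewrite /d (addrC x (y - x)) subrK -/d => ->.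
have bs (s : R) : 0 <= s <= 1 -> box lo up (x + s *: (t *: d)).
  move=> /andP[s0 s1]; rewrite scalerA; apply: bz.
  by move: t01 => /andP[t0 t1]; apply/andP; split; nra.
have dgrad (s : R) (s01 : 0 <= s <= 1) := @derive_dot_hess _ _ f _ d (t *: d)
  (let: And3 _ p _ := fC2 _ (bU _ (bs s s01)) in p).
have [s s01] := @mean_value_line _ _ (fun z => dot (grad f z) d) x (t *: d)
  (fun s s01 => (dgrad s s01).1).
rewrite (dgrad s s01).2 => ->.
rewrite (le_trans (dotC _ _))// ler_wpM2l//.
apply: (@le_trans _ _ (B * nrm (t *: d) * nrm d)).
  rewrite ler_wpM2r ?norm_ge0// (le_trans (le_induced_norm _ _ h))//.
  by rewrite ler_wpM2r ?norm_ge0// hB//; exact: bs.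
move: t01 => /andP[t0 t1]; rewrite (norm_scale h) ger0_norm// expr2.
rewrite (_ : B * (t * nrm d) * nrm d = t * (B * (nrm d * nrm d))); last by ring.
by rewrite ler_piMl.
Qed.

(** * Projected gradients and curvature *)

Lemma clip_nonexpansive (R : realType) (l u a b : R) :
  `|Num.max l (Num.min u a) - Num.max l (Num.min u b)| <= `|a - b|.
Proof.
wlog ab : a b / b <= a => [H|].
  by have [/H//|/ltW/H] := leP b a; rewrite distrC (distrC b).
have mono : Num.max l (Num.min u b) <= Num.max l (Num.min u a).
  by rewrite ge_max !le_max lexx/= le_min !ge_min lexx ab !orbT.
rewrite !ger0_norm ?subr_ge0// lerBlDr ge_max.
have := lexx (Num.max l (Num.min u b)); rewrite {1}ge_max => /andP[lb mb].
apply/andP; split; first by lra.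
have [ub|bu] := leP u b; last first.
  by rewrite ge_min; apply/orP; right; rewrite (min_r (ltW bu)) in mb; lra.
by rewrite ge_min; apply/orP; left; rewrite (min_l ub) in mb; lra.
Qed.

(** Nonexpansiveness of the projection holds coordinatewise; transferring it to
an arbitrary norm costs the constant of the equivalence of norms. *)
Lemma proj_grad_perturb (R : realType) N (nrm : 'cV[R]_N -> R) : is_norm nrm ->
  exists2 K : R, 0 <= K & forall (lo up : 'cV[R]_N) f g x,
    nrm (proj_grad lo up f x) <=
    nrm (proj_grad lo up g x) + K * nrm (grad g x - grad f x).
Proof.
move=> h; have [C C0 nrmC] := norm_le_coord h.
have [c c0 nrmc] := coord_le_norm h.
exists (C * c) => [|lo up f g x]; first by rewrite mulr_ge0.
rewrite -[X in nrm X <= _](subrK (proj_grad lo up g x)) addrC.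
rewrite (le_trans (norm_triangle h _ _))// lerD2l -mulrA nrmC// => i.
apply: le_trans (nrmc _ i); rewrite /proj_grad opprB subrKA !mxE.
apply: le_trans (clip_nonexpansive _ _ _ _) _.
by rewrite (_ : x i 0 - 'D_(delta_mx i 0) f x - (x i 0 - 'D_(delta_mx i 0) g x) =
  'D_(delta_mx i 0) g x - 'D_(delta_mx i 0) f x)//; ring.
Qed.

(** Empty and unbounded sets are covered because their [sup] is [0]. *)
Lemma sup_ge0 (R : realType) (A : set R) : (forall y, A y -> 0 <= y) -> 0 <= sup A.
Proof.
move=> A0; have [hA|/sup_out->//] := pselect (has_sup A).
have [[y Ay] _] := hA.
exact: le_trans (A0 _ Ay) (sup_upper_bound hA Ay).
Qed.

Lemma spectral_norm_ge0 (R : realType) N (A : 'M[R]_N) : 0 <= spectral_norm A.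
Proof.
apply: sup_ge0 => _ [x _ <-]; exact: sqrtr_ge0.
Qed.

(** Positivity of the curvature bound is what lets a uniform upper bound [beta]
replace it in the denominator of the decrease condition. *)
Lemma curvature_bound_ge1 (R : realType) N (nrm : 'cV[R]_N -> R)
    (lo up center : 'cV[R]_N) (r : R) (f : 'cV[R]_N -> R) :
  1 <= curvature_bound nrm lo up center r f.
Proof.
by rewrite lerDl; apply: sup_ge0 => _ [x _ <-]; exact: spectral_norm_ge0.
Qed.

(** * Trust-region runs *)

(** Radii up to [delta] do not decrease, so the radius gets below [delta] only by
a single shrinking step from above [delta]. *)
Lemma radius_bounded_below (R : realType) (D : nat -> R) (gamma delta : R) K :
  0 < gamma ->
  (forall k, (K <= k)%N -> gamma * D k <= D k.+1) ->
  (forall k, (K <= k)%N -> D k <= delta -> D k <= D k.+1) ->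
  forall k, (K <= k)%N -> Num.min (D K) (gamma * delta) <= D k.
Proof.
move=> g0 shrink grow; elim=> [|k IH].
  by rewrite leqn0 => /eqP <-; rewrite ge_min lexx.
rewrite leq_eqVlt ltnS => /predU1P[<-|Kk]; first by rewrite ge_min lexx.
have [Dd|dD] := leP (D k) delta; first exact: le_trans (IH Kk) (grow _ Kk Dd).
rewrite (le_trans _ (shrink _ Kk))// ge_min; apply/orP; right.
by rewrite ler_pM2l// ltW.
Qed.

Lemma no_endless_decrease (R : realType) (f : nat -> R) (L c : R) K :
  0 < c -> (forall k, (K <= k)%N -> L <= f k) ->
  ~ (forall k, (K <= k)%N -> f k.+1 <= f k - c).
Proof.
move=> c0 fL dec.
have fn n : f (K + n)%N <= f K - n%:R * c.
  elim: n => [|n IH]; first by rewrite addn0 mul0r subr0.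
  rewrite addnS (le_trans (dec _ (leq_addr _ _)))//.
  by rewrite -natr1 mulrDl mul1r opprD addrA lerD2r.
have := fL _ (leq_addr (Num.bound ((f K - L) / c)) K).
apply/negP; rewrite -ltNge (le_lt_trans (fn _))//.
rewrite ltrBlDr -ltrBlDl -ltr_pdivrMr//.
apply: archi_boundP; rewrite divr_ge0 ?(ltW c0)// subr_ge0; exact: fL.
Qed.

(** The potential [f + a * D] decreases by a fixed amount either way. A decrease
of [f] by [c] may come with an increase of [D], but that increase costs at most
[a * Dmax = c / 2]; a shrinking of [D] removes at least [(1 - g) * Dmin]. *)
Lemma no_endless_decrease_or_shrinking (R : realType) (f D : nat -> R)
    (L Dmin Dmax c g : R) K :
  0 < c -> g < 1 -> 0 < Dmin ->
  (forall k, (K <= k)%N -> L <= f k) ->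
  (forall k, (K <= k)%N -> Dmin <= D k <= Dmax) ->
  ~ (forall k, (K <= k)%N -> f k.+1 <= f k - c \/
                           f k.+1 <= f k /\ D k.+1 <= g * D k).
Proof.
move=> c0 g1 Dm0 fL DD step.
have DM0 : 0 < Dmax by have /andP[? ?] := DD K (leqnn K); lra.
pose a := c / (2 * Dmax).
have a0 : 0 < a by rewrite divr_gt0// mulr_gt0.
have aD : a * Dmax = c / 2 by rewrite /a; field; rewrite gt_eqF.
have d0 : 0 < Num.min (c / 2) (a * ((1 - g) * Dmin)).
  rewrite lt_min; apply/andP; split; first exact: divr_gt0.
  by rewrite mulr_gt0// mulr_gt0// subr_gt0.
apply: (@no_endless_decrease _ (fun k => f k + a * D k) L _ K d0) => k Kk.
  have /andP[Dk _] := DD k Kk; rewrite (le_trans (fL _ Kk))// lerDl.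
  by rewrite mulr_ge0// ltW// (lt_le_trans Dm0).
have /andP[Dk _] := DD k Kk; have /andP[_ Dk1] := DD k.+1 (leqW Kk).
rewrite lerBrDr -lerBrDl; case: (step k Kk) => [fk|[fk Dg]].
- rewrite ge_min; apply/orP; left.
  have : a * D k.+1 <= a * Dmax by rewrite ler_pM2l.
  have : 0 <= a * D k by rewrite mulr_ge0 ?ltW// (lt_le_trans Dm0).
  by rewrite aD; lra.
- rewrite ge_min; apply/orP; right.
  have aDg : a * D k.+1 <= a * (g * D k) by rewrite ler_pM2l.
  have : a * ((1 - g) * Dmin) <= a * ((1 - g) * D k).
    by rewrite ler_pM2l// ler_pM2l ?subr_gt0.
  by move: aDg; rewrite !mulrBl !mulrBr !mul1r; lra.
Qed.

Lemma tr_run_box (R : realType) N (nrm : 'cV[R]_N -> R) lo up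
    (gamma1 gamma2 Delta_max eta1 eta2 : R) F m mu cand Delta :
  tr_run nrm lo up gamma1 gamma2 Delta_max eta1 eta2 F m mu cand Delta ->
  forall k, box lo up (mu k).
Proof.
move=> run; elim=> [|k IH]; first exact: (tr_start run).
have [acc|rej] := leP eta1 (reduction_ratio F (m k) (mu k) (cand k)).
  by rewrite (tr_accept run acc); have [] := tr_cand run k.
by rewrite (tr_reject run rej).
Qed.

Lemma tr_run_shrink (R : realType) N (nrm : 'cV[R]_N -> R) lo up
    (gamma1 gamma2 Delta_max eta1 eta2 : R) F m mu cand Delta :
  tr_run nrm lo up gamma1 gamma2 Delta_max eta1 eta2 F m mu cand Delta ->
  0 < gamma1 -> gamma1 <= gamma2 -> gamma2 < 1 ->
  forall k, 0 < Delta k <= Delta_max /\ gamma1 * Delta k <= Delta k.+1.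
Proof.
move=> run g10 g12 g21.
have step k : 0 < Delta k <= Delta_max ->
    gamma1 * Delta k <= Delta k.+1 <= Delta_max.
  move=> /andP[D0 DM].
  have [acc|rej] := leP eta1 (reduction_ratio F (m k) (mu k) (cand k)).
    have [vs|nvs] := leP eta2 (reduction_ratio F (m k) (mu k) (cand k)).
      have /andP[? ->] := tr_radius_very_success run vs.
      by rewrite andbT; nra.
    have /andP[? ?] := tr_radius_success run (introT andP (conj acc nvs)).
    by apply/andP; split; nra.
  have /andP[-> ?] := tr_radius_fail run rej.
  by rewrite /=; nra.
have pos k : 0 < Delta k <= Delta_max.
  elim: k => [|k IH]; first exact: (tr_start_radius run).
  have /andP[D1 ->] := step k IH; rewrite andbT (lt_le_trans _ D1)//.
  by rewrite mulr_gt0//; case/andP: IH.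
by move=> k; split; [exact: pos|have /andP[] := step k (pos k)].
Qed.

(** Subtracting the two expansions at [x] leaves the pairing of the gradient
error with the step, and the two remainders. A gradient error proportional to
the radius makes all three quadratic in the radius. *)
Lemma reduction_error (R : realType) N (nrm : 'cV[R]_N -> R)
    (lo up : 'cV[R]_N) (U : set 'cV[R]_N) (C B1 B2 e : R)
    (f g : 'cV[R]_N -> R) (x y : 'cV[R]_N) (r : R) :
  is_norm nrm -> box lo up `<=` U -> twice_cont_diff U f -> twice_cont_diff U g ->
  0 <= C -> (forall u v : 'cV[R]_N, `|dot u v| <= C * (nrm u * nrm v)) ->
  0 <= B1 -> 0 <= B2 ->
  (forall z, box lo up z -> induced_norm nrm (hess f z) <= B1) ->
  (forall z, box lo up z -> induced_norm nrm (hess g z) <= B2) ->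
  box lo up x -> trust_region nrm lo up x r y ->
  nrm (grad g x - grad f x) <= e * r ->
  `|(f x - f y) - (g x - g y)| <= C * (e + B1 + B2) * r ^+ 2.
Proof.
move=> h bU fC2 gC2 C0 dotC B10 B20 hf hg bx [by_ xy] ge.
have Tf := taylor_box h bU fC2 C0 dotC B10 hf bx by_.
have Tg := taylor_box h bU gC2 C0 dotC B20 hg bx by_.
have n0 := norm_ge0 (y - x) h.
have n2 : nrm (y - x) ^+ 2 <= r ^+ 2 by rewrite lerXn2r ?nnegrE// (le_trans n0).
have dge : `|dot (grad g x - grad f x) (y - x)| <= C * (e * r * r).
  rewrite (le_trans (dotC _ _))// ler_wpM2l// ler_pM ?norm_ge0//.
have {Tf} := le_trans Tf (ler_wpM2l C0 (ler_wpM2l B10 n2)).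
have {Tg} := le_trans Tg (ler_wpM2l C0 (ler_wpM2l B20 n2)).
move: dge; rewrite dotBl !ler_norml.
move=> /andP[d1 d2] /andP[g1 g2] /andP[f1 f2].
rewrite (_ : C * (e + B1 + B2) * r ^+ 2 =
  C * (e * r * r) + C * (B1 * r ^+ 2) + C * (B2 * r ^+ 2)); last by ring.
by apply/andP; split; lra.
Qed.

(** The criticality measure enters only through the decrease condition, hence
the abstract [chi]. *)
Lemma tr_run_not_bounded_away (R : realType) N (nrm : 'cV[R]_N -> R) lo up
    (gamma1 gamma2 Delta_max eta1 eta2 : R) F m mu cand Delta
    (chi : nat -> R) (L A beta kappa : R) :
  tr_run nrm lo up gamma1 gamma2 Delta_max eta1 eta2 F m mu cand Delta ->
  0 < gamma1 -> gamma1 <= gamma2 -> gamma2 < 1 ->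
  0 < eta1 -> eta2 < 1 -> 0 < A -> 0 < beta -> 0 < kappa ->
  (forall k, L <= F (mu k)) ->
  (forall k, `|(F (mu k) - F (cand k)) - (m k (mu k) - m k (cand k))| <=
             A * Delta k ^+ 2) ->
  (forall k, kappa * chi k * Num.min (chi k / beta) (Delta k) <=
             m k (mu k) - m k (cand k)) ->
  forall e K, 0 < e -> ~ (forall k, (K <= k)%N -> e <= chi k).
Proof.
move=> run g10 g12 g21 e10 e21 A0 b0 k0 FL err dec e K e0 chie.
have D0 k : 0 < Delta k by have [/andP[]] := tr_run_shrink run g10 g12 g21 k.
have DM k : Delta k <= Delta_max.
  by have [/andP[]] := tr_run_shrink run g10 g12 g21 k.
have shrink k : gamma1 * Delta k <= Delta k.+1.
  by have [] := tr_run_shrink run g10 g12 g21 k.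
have mdec k : (K <= k)%N ->
    kappa * e * Num.min (e / beta) (Delta k) <= m k (mu k) - m k (cand k).
  move=> Kk; apply: le_trans (dec k); have ce := chie k Kk.
  have m0 : 0 <= Num.min (e / beta) (Delta k).
    by rewrite le_min divr_ge0 ?ltW// D0.
  rewrite ler_pM// ?mulr_ge0 ?(ltW k0) ?(ltW e0)// ?ler_pM2l//.
  by rewrite le_min2 ?ler_pM2r ?invr_gt0.
(* Below [e / beta] the predicted reduction is linear in the radius; below the
   second bound it exceeds the quadratic error by the factor needed for
   [eta2]. *)
pose delta := Num.min (e / beta) ((1 - eta2) * (kappa * e) / A).
have ke0 : 0 < kappa * e by rewrite mulr_gt0.
have eb0 : 0 < e / beta by rewrite divr_gt0.
have delta0 : 0 < delta.
  by rewrite lt_min eb0 divr_gt0// mulr_gt0// subr_gt0.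
have mpos k : (K <= k)%N -> 0 < m k (mu k) - m k (cand k).
  move=> Kk; apply: lt_le_trans (mdec k Kk); rewrite mulr_gt0// lt_min eb0/=.
  exact: D0.
have grow k : (K <= k)%N -> Delta k <= delta -> Delta k <= Delta k.+1.
  move=> Kk; rewrite le_min => /andP[Deb]; rewrite ler_pdivlMr// => DA.
  suff vs : eta2 <= reduction_ratio F (m k) (mu k) (cand k).
    by have /andP[] := tr_radius_very_success run vs.
  rewrite /reduction_ratio ler_pdivlMr ?mpos//.
  have := mdec k Kk; rewrite (min_r Deb) => md.
  have := err k; rewrite ler_norml => /andP[er _].
  have : A * Delta k ^+ 2 <= (1 - eta2) * (m k (mu k) - m k (cand k)).
    apply: (@le_trans _ _ ((1 - eta2) * (kappa * e * Delta k))).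
      rewrite expr2 mulrA (mulrA (1 - eta2)) ler_pM2r//.
      by rewrite mulrC.
    by rewrite ler_pM2l ?subr_gt0.
  by rewrite mulrBl mul1r; lra.
pose Dmin := Num.min (Delta K) (gamma1 * delta).
have Dmin0 : 0 < Dmin by rewrite lt_min D0 mulr_gt0.
have Dlow k : (K <= k)%N -> Dmin <= Delta k.
  by apply: radius_bounded_below => // ? _; exact: shrink.
pose c := eta1 * (kappa * e * Num.min (e / beta) Dmin).
have c0 : 0 < c by rewrite !mulr_gt0// lt_min eb0.
apply: (@no_endless_decrease_or_shrinking _ (fun k => F (mu k)) Delta
  L Dmin Delta_max c gamma2 K)
  => // [k Kk|k Kk]; first by rewrite Dlow ?DM.
have [acc|rej] := leP eta1 (reduction_ratio F (m k) (mu k) (cand k)).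
- left; rewrite (tr_accept run acc).
  have : c <= F (mu k) - F (cand k).
    move: acc; rewrite /reduction_ratio ler_pdivlMr ?mpos//; apply: le_trans.
    rewrite ler_pM2l// (le_trans _ (mdec k Kk))// ler_pM2l//.
    by rewrite le_min2 ?Dlow.
  by lra.
- right; rewrite (tr_reject run rej); split=> //.
  by have /andP[] := tr_radius_fail run rej.
Qed.

Theorem theorem2 (R : realType) (N : nat) (nrm : 'cV[R]_N -> R)
    (lo up : 'cV[R]_N) (U : set 'cV[R]_N)
    (gamma1 gamma2 Delta_max eta1 eta2 : R)
    (F : 'cV[R]_N -> R) (m : nat -> 'cV[R]_N -> R)
    (mu cand : nat -> 'cV[R]_N) (Delta : nat -> R)
    (nrm_norm : is_norm nrm)
    (lo_le_up : forall i, lo i 0 <= up i 0)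
    (U_open : open U) (box_sub_U : box lo up `<=` U)
    (gamma1_gt0 : 0 < gamma1) (gamma12 : gamma1 <= gamma2) (gamma2_lt1 : gamma2 < 1)
    (Delta_max_gt0 : 0 < Delta_max)
    (eta1_gt0 : 0 < eta1) (eta12 : eta1 < eta2) (eta2_lt1 : eta2 < 1)
    (run : tr_run nrm lo up gamma1 gamma2 Delta_max eta1 eta2 F m mu cand Delta)
    (F_C2 : twice_cont_diff U F)
    (F_bounded_below : exists L : R, forall x, U x -> L <= F x)
    (m_C2 : forall k, twice_cont_diff U (m k))
    (hess_bounded : exists zeta1 zeta2 : R, [/\ 0 < zeta1, 1 < zeta2,
       forall x, box lo up x -> induced_norm nrm (hess F x) <= zeta1
       & forall k x, box lo up x -> induced_norm nrm (hess (m k) x) <= zeta2 - 1])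
    (grad_inexact : exists xi : R, 0 < xi /\ forall k,
       nrm (grad (m k) (mu k) - grad F (mu k)) <=
       xi * Num.min (nrm (proj_grad lo up (m k) (mu k))) (Delta k))
    (beta_bounded : exists beta : R, 0 < beta /\ forall k,
       curvature_bound nrm lo up (mu k) (Delta k) (m k) <= beta)
    (sufficient_decrease : exists kappa : R, 0 < kappa < 1 /\ forall k,
       m k (mu k) - m k (cand k) >=
       kappa * nrm (proj_grad lo up (m k) (mu k)) *
       Num.min (nrm (proj_grad lo up (m k) (mu k)) /
                curvature_bound nrm lo up (mu k) (Delta k) (m k))
               (Delta k)) :
  limn_einf (fun k => (nrm (proj_grad lo up (m k) (mu k)))%:E) = 0%E /\
  limn_einf (fun k => (nrm (proj_grad lo up F (mu k)))%:E) = 0%E.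
Proof.
have [L FL] := F_bounded_below.
have [zeta1 [zeta2 [z10 z21 hF hm]]] := hess_bounded.
have [xi [xi0 gerr]] := grad_inexact.
have [beta [beta0 curv]] := beta_bounded.
have [kappa [/andP[kappa0 _] dec]] := sufficient_decrease.
have [C C0 dotC] := dot_le_norm nrm_norm.
have [Kp Kp0 perturb] := proj_grad_perturb nrm_norm.
have bmu := tr_run_box run.
pose chi k := nrm (proj_grad lo up (m k) (mu k)).
have chi0 k : 0 <= chi k by exact: norm_ge0.
have chi_small : forall e K, 0 < e -> exists2 k, (K <= k)%N & chi k < e.
  apply: arbitrarily_small_of_not_bounded_away.
  (* [C + 1] instead of [C], since the constant must be positive. *)
  have s0 : 0 < xi + zeta1 + (zeta2 - 1) by lra.
  have A0 : 0 < (C + 1) * (xi + zeta1 + (zeta2 - 1)).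
    by rewrite mulr_gt0// ltr_wpDl.
  apply: (tr_run_not_bounded_away run _ _ _ _ _ A0 beta0 kappa0) => // k.
  - exact/FL/box_sub_U.
  - have := @reduction_error _ _ nrm lo up U C zeta1 (zeta2 - 1) xi F (m k)
      (mu k) (cand k) (Delta k) nrm_norm box_sub_U F_C2 (m_C2 k) C0 dotC
      (ltW z10) _ hF (hm k) (bmu k) (tr_cand run k).
    rewrite subr_ge0 => /(_ (ltW z21)) E.
    apply: (le_trans (E _)).
      by rewrite (le_trans (gerr k))// ler_wpM2l ?(ltW xi0)// ge_min lexx orbT.
    by rewrite ler_wpM2r ?sqr_ge0// ler_wpM2r ?(ltW s0)// lerDl.
  - apply: le_trans (dec k); rewrite ler_wpM2l ?mulr_ge0 ?(ltW kappa0)//.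
    rewrite le_min2// ler_wpM2l// ?chi0// lef_pV2 ?curv// posrE//.
    exact: lt_le_trans ltr01 (curvature_bound_ge1 _ _ _ _ _ _).
split; apply: limn_einf_eq0 => //; first by move=> k; exact: norm_ge0.
move=> e K e0.
have P0 : 0 < 1 + Kp * xi by rewrite ltr_wpDr// mulr_ge0// ltW.
have [k Kk ck] := chi_small (e / (1 + Kp * xi)) K (divr_gt0 e0 P0).
exists k => //; rewrite ltr_pdivlMr// in ck; apply: le_lt_trans ck.
apply: (le_trans (perturb lo up F (m k) (mu k))).
rewrite mulrDr mulr1 lerD2l [leRHS]mulrC -mulrA ler_wpM2l//.
by rewrite (le_trans (gerr k))// ler_pM2l// ge_min lexx.
Qed.
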